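(* The system $\mathsf{ACA}_0^\omega+\Delta\text{-}\mathsf{CA}$ proves the implication $\mathsf{CLO}\rightarrow\mathsf{RANGE}$, where $\mathsf{CLO}$ is the statement: every separably closed set in $\mathbb{R}$ is RM-closed; and $\mathsf{RANGE}$ is the statement $$(\forall G^{2})(\exists X^{1})(\forall n^{0})\big[n\in X\leftrightarrow (\exists f^{1})(G(f)=n)\big].$$
   Context: Finite types: $0$ is a type (natural numbers), and if $\sigma,\tau$ are types, so is $\sigma\to\tau$; $1\equiv 0\to 0$ and $n+1\equiv n\to 0$. Superscripts indicate types. Type $1$ objects are elements of $\mathbb{N}^{\mathbb{N}}$, type $2$ objects are functionals $\mathbb{N}^{\mathbb{N}}\to\mathbb{N}$. Pairs and finite sequences are coded as usual. $\mathsf{L}_\omega$ is the language with variables of every finite type, constants $0,1,<_0,+_0,\times_0,=_0$, the combinators $\Pi,\Sigma$ and the recursor $\mathbf{R}_0$. For $\tau=(\tau_1\to\dots\to\tau_k\to 0)$, $x=_\tau y$ means $(\forall z_1^{\tau_1}\dots z_k^{\tau_k})(xz_1\dots z_k=_0 yz_1\dots z_k)$. The system $\mathsf{RCA}_0^\omega$ has the axioms: (a) $0,1,<_0,+_0,\times_0$ form an ordered semi-ring with equality $=_0$; (b) the defining axioms of the combinators $\Pi,\Sigma$ (giving $\lambda$-abstraction); (c) $\mathbf{R}_0(f^1,m^0,0)=m$ and $\mathbf{R}_0(f,m,n+1)=f(n,\mathbf{R}_0(f,m,n))$; (d) extensionality: $(\forall x^\rho,y^\rho,\varphi^{\rho\to\tau})(x=_\rho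 y\to\varphi(x)=_\tau\varphi(y))$ for all types $\rho,\tau$; (e) induction for quantifier-free formulas of $\mathsf{L}_\omega$; (f) $\mathsf{QF}\text{-}\mathsf{AC}^{1,0}$, where $\mathsf{QF}\text{-}\mathsf{AC}^{\sigma,\tau}$ is $(\forall x^\sigma)(\exists y^\tau)A(x,y)\to(\exists Y^{\sigma\to\tau})(\forall x^\sigma)A(x,Y(x))$ for quantifier-free $A$ of $\mathsf{L}_\omega$. $\mathsf{ACA}_0^\omega$ is $\mathsf{RCA}_0^\omega+(\mu^2)$, where $(\mu^2)$ is $(\exists\mu^2)(\forall f^1)\big[(\exists n)(f(n)=0)\to[f(\mu(f))=0\wedge(\forall i<\mu(f))f(i)\neq0]\wedge[(\forall n)(f(n)\neq 0)\to\mu(f)=0]\big]$. $\Delta\text{-}\mathsf{CA}$ is: $(\forall Y^2,Z^2)\big[(\forall n^0)\big((\exists f^1)(Y(f,n)=0)\leftrightarrow(\forall g^1)(Z(g,n)=0)\big)\to(\exists X^1)(\forall n^0)(n\in X\leftrightarrow(\exists f^1)(Y(f,n)=0))\big]$. Sets are given by characteristic functions: $X\subseteq\mathbb{N}$ is a type $1$ object, $D\subseteq\mathbb{N}^{\mathbb{N}}$ is given by a type $2$ functional, and a binary relation on $D$ by a functional of type $(1\times1)\to0$. Real numbers are represented by fast-converging Cauchy sequences of rationals $q_{(\cdot)}$, i.e. $|q_n-q_{n+i}|<2^{-n}$ for all $n,i$. A set $D\neq\emptyset$ with a binary relation $\preceq$ is directed if $\preceq$ is transitive and reflexive on $D$ and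 for all $x,y\in D$ there is $z\in D$ with $x\preceq z\wedge y\preceq z$. A net is a mapping $x_d$ with domain such a directed set $D$. A separably closed set $\overline S$ in $\mathbb{R}$ is given by a net $x_d:D\to\mathbb{Q}$ with $D\subseteq\mathbb{N}^{\mathbb{N}}$, where ''$x\in\overline S$'' stands for $(\forall k^0)(\exists d\in D)(|x-x_d|\leq\frac1{2^k})$. An RM-closed set is the complement of an RM-open set, and an RM-open set is one given by a countable union of open intervals (as in second-order Reverse Mathematics, i.e. by a sequence of open intervals with rational endpoints). *)

(* Defs.v *)
From Stdlib Require Import List.
Import ListNotations.

Set Implicit Arguments.
Unset Strict Implicit.

Inductive ty : Set :=
| N : ty
| Arr : ty -> ty -> ty.

Declare Scope ty_scope.
Delimit Scope ty_scope with ty.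
Bind Scope ty_scope with ty.
Notation "s ⇒ t" := (Arr s t) (at level 55, right associativity) : ty_scope.
Notation T1 := (Arr N N).
Notation T2 := (Arr T1 N).

(* Functions of several arguments are curried throughout: "Y(f,n)" with Y of
   type 2 is [Y · f · n] with Y of type 1 ⇒ 0 ⇒ 0, a functional of type
   (1 x 1) -> 0 has type 1 ⇒ 1 ⇒ 0, and the first argument f(n,m) of the
   recursor has type 0 ⇒ 0 ⇒ 0. *)
Inductive cst : ty -> Set :=
| Czero : cst N
| Cone : cst N
| Cadd : cst (N ⇒ N ⇒ N)
| Cmul : cst (N ⇒ N ⇒ N)
| CPi (r t : ty) : cst (r ⇒ t ⇒ r)
| CSigma (r s t : ty) : cst ((r ⇒ s ⇒ t) ⇒ (r ⇒ s) ⇒ r ⇒ t)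
| CRec : cst ((N ⇒ N ⇒ N) ⇒ N ⇒ N ⇒ N).

(* Typed de Bruijn variables; a context lists the types of the free variables. *)
Inductive var : list ty -> ty -> Set :=
| vz (G : list ty) (s : ty) : var (s :: G) s
| vs (G : list ty) (s t : ty) : var G t -> var (s :: G) t.

Inductive term (G : list ty) : ty -> Set :=
| Var (t : ty) : var G t -> term G t
| Cst (t : ty) : cst t -> term G t
| App (s t : ty) : term G (s ⇒ t) -> term G s -> term G t.

Arguments vz {G s}.
Arguments vs {G s t} _.
Arguments Var {G t} _.
Arguments Cst {G t} _.
Arguments App {G s t} _ _.

Inductive fm (G : list ty) : Set :=
| Eq : term G N -> term G N -> fm G
| Lt : term G N -> term G N -> fm G
| Bot : fm G
| Imp : fm G -> fm G -> fm G
| All (s : ty) : fm (s :: G) -> fm G.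

Arguments Bot {G}.
Arguments All {G} s _.

Declare Scope fm_scope.
Delimit Scope fm_scope with fm.
Bind Scope fm_scope with fm.
Bind Scope fm_scope with term.
Open Scope ty_scope.
Open Scope fm_scope.

Notation zero := (Cst Czero).
Notation one := (Cst Cone).
Notation "s · t" := (App s t) (at level 38, left associativity) : fm_scope.
Notation "s + t" := (App (App (Cst Cadd) s) t) : fm_scope.
Notation "s * t" := (App (App (Cst Cmul) s) t) : fm_scope.
Notation Pi r t := (Cst (CPi r t)) (only parsing).
Notation Sigma r s t := (Cst (CSigma r s t)).
Notation Rec := (Cst CRec).

Notation "s ≐ t" := (Eq s t) (at level 70) : fm_scope.
Notation "s < t" := (Lt s t) : fm_scope.
Notation "A ⟶ B" := (Imp A B) (at level 90, right associativity) : fm_scope.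

(* The logic is classical, so the other connectives are defined. *)
Definition Neg G (A : fm G) : fm G := A ⟶ Bot.
Definition And G (A B : fm G) : fm G := Neg (A ⟶ Neg B).
Definition Or G (A B : fm G) : fm G := Neg A ⟶ B.
Definition Iff G (A B : fm G) : fm G := And (A ⟶ B) (B ⟶ A).
Definition Exi G (s : ty) (A : fm (s :: G)) : fm G := Neg (All s (Neg A)).

Notation "¬ A" := (Neg A) (at level 75, right associativity) : fm_scope.
Notation "A ∧ B" := (And A B) (at level 80, right associativity) : fm_scope.
Notation "A ∨ B" := (Or A B) (at level 85, right associativity) : fm_scope.
Notation "A ⟷ B" := (Iff A B) (at level 95, no associativity) : fm_scope.

Fixpoint qf G (A : fm G) : Prop :=
  match A with
  | Eq _ _ | Lt _ _ | Bot => True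
  | Imp A B => qf A /\ qf B
  | All _ _ => False
  end.

Definition renaming (G D : list ty) := forall t, var G t -> var D t.
Definition substitution (G D : list ty) := forall t, var G t -> term D t.

Fixpoint ren G D (r : renaming G D) t (u : term G t) : term D t :=
  match u with
  | Var x => Var (r _ x)
  | Cst c => Cst c
  | App u v => App (ren r u) (ren r v)
  end.

Fixpoint sub G D (r : substitution G D) t (u : term G t) : term D t :=
  match u with
  | Var x => r _ x
  | Cst c => Cst c
  | App u v => App (sub r u) (sub r v)
  end.

Definition scons G D s (u : term D s) (r : substitution G D) :
  substitution (s :: G) D :=
  fun t x =>
    match x in var G' t' return
      match G' with
      | [] => unit
      | s' :: G0 => term D s' -> substitution G0 D -> term D t'
      end
    with
    | vz => fun u _ => u
    | vs y => fun _ r => r _ y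
    end u r.

Definition wk G s t (u : term G t) : term (s :: G) t := ren (fun _ => vs) u.

Definition ren_up G D s (r : renaming G D) : renaming (s :: G) (s :: D) :=
  fun t x =>
    match x in var G' t' return
      match G' with
      | [] => unit
      | s' :: G0 => renaming G0 D -> var (s' :: D) t'
      end
    with
    | vz => fun _ => vz
    | vs y => fun r => vs (r _ y)
    end r.

Definition sub_up G D s (r : substitution G D) : substitution (s :: G) (s :: D) :=
  scons (Var vz) (fun t x => wk s (r t x)).

Fixpoint renf G D (r : renaming G D) (A : fm G) : fm D :=
  match A with
  | Eq u v => Eq (ren r u) (ren r v)
  | Lt u v => Lt (ren r u) (ren r v)
  | Bot => Bot
  | Imp A B => Imp (renf r A) (renf r B)
  | All s A => All s (renf (ren_up (s := s) r) A)
  end.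

Fixpoint subf G D (r : substitution G D) (A : fm G) : fm D :=
  match A with
  | Eq u v => Eq (sub r u) (sub r v)
  | Lt u v => Lt (sub r u) (sub r v)
  | Bot => Bot
  | Imp A B => Imp (subf r A) (subf r B)
  | All s A => All s (subf (sub_up (s := s) r) A)
  end.

Definition wkf G s (A : fm G) : fm (s :: G) := renf (fun _ => vs) A.

Definition inst G s (A : fm (s :: G)) (u : term G s) : fm G :=
  subf (scons u (fun _ => Var)) A.

(* A theory may contain open formulas; these act as their universal closures. *)
Definition theory := forall G : list ty, fm G -> Prop.

Inductive prov (T : theory) : forall G : list ty, list (fm G) -> fm G -> Prop :=
| p_ax G (H : list (fm G)) A : T G A -> prov T H A
| p_hyp G (H : list (fm G)) A : In A H -> prov T H A
| p_impI G (H : list (fm G)) A B : prov T (A :: H) B -> prov T H (A ⟶ B)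
| p_impE G (H : list (fm G)) A B : prov T H (A ⟶ B) -> prov T H A -> prov T H B
| p_raa G (H : list (fm G)) A : prov T ((¬ A) :: H) Bot -> prov T H A
| p_allI G (H : list (fm G)) s (A : fm (s :: G)) :
    prov T (map (@wkf G s) H) A -> prov T H (All s A)
| p_allE G (H : list (fm G)) s (A : fm (s :: G)) (u : term G s) :
    prov T H (All s A) -> prov T H (inst A u)
| p_refl G (H : list (fm G)) (u : term G N) : prov T H (u ≐ u)
| p_leibniz G (H : list (fm G)) (A : fm (N :: G)) (u v : term G N) :
    prov T H (u ≐ v) -> prov T H (inst A u) -> prov T H (inst A v).

Definition provable (T : theory) (A : fm []) : Prop := prov T [] A.

(** [∀' x ∶ s, A] binds [x] as the term [Var vz] in the context [s :: G];
    [↑ u] transports a term into any context extending its own, the weakening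
    being found by type class resolution.  After unfolding, only ordinary
    de Bruijn formulas remain. *)

Class extends (G D : list ty) : Set := ext_ren : renaming G D.
#[export] Instance extends_refl G : extends G G | 0 := fun _ x => x.
#[export] Instance extends_skip G D s (e : extends G D) : extends G (s :: D) | 1 :=
  fun t x => vs (e t x).

Definition lift G D (e : extends G D) t (u : term G t) : term D t := ren (ext_ren (extends := e)) u.
Arguments lift {G D e t} u.
Notation "↑ u" := (lift u) (at level 8, u at level 8, format "↑ u") : fm_scope.

Definition all_ G s (A : term (s :: G) s -> fm (s :: G)) : fm G := All s (A (Var vz)).
Definition exi_ G s (A : term (s :: G) s -> fm (s :: G)) : fm G := Exi (A (Var vz)).
Arguments all_ {G} s A.
Arguments exi_ {G} s A.
Notation "∀' x ∶ s , A" := (all_ s (fun x => A))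
  (at level 200, x name, s at level 60, A at level 200) : fm_scope.
Notation "∃' x ∶ s , A" := (exi_ s (fun x => A))
  (at level 200, x name, s at level 60, A at level 200) : fm_scope.

Fixpoint eqt G (t : ty) : term G t -> term G t -> fm G :=
  match t with
  | N => fun u v => u ≐ v
  | Arr s t => fun u v => ∀' z ∶ s, eqt (↑u · ↑z) (↑v · ↑z)
  end.

(* A(n+1), for A(n) with distinguished variable n. *)
Definition inst_succ G (A : fm (N :: G)) : fm (N :: G) :=
  subf (scons (Var vz + one) (fun _ x => Var (vs x))) A.

(* A(x, Y x) in the context x, Y, G, for A with variables y, x, G. *)
Definition inst_choice G s t (A : fm (t :: s :: G)) : fm (s :: (s ⇒ t) :: G) :=
  subf (scons (Var (vs vz) · Var vz)
       (scons (Var vz) (fun _ x => Var (vs (vs x))))) A.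

Definition QF_AC G s t (A : fm (t :: s :: G)) : fm G :=
  All s (Exi A) ⟶ Exi (All s (inst_choice A)).

Inductive RCA0w : theory :=
| ax_addA G (x y z : term G N) : RCA0w ((x + y) + z ≐ x + (y + z))
| ax_addC G (x y : term G N) : RCA0w (x + y ≐ y + x)
| ax_add0 G (x : term G N) : RCA0w (x + zero ≐ x)
| ax_mulA G (x y z : term G N) : RCA0w ((x * y) * z ≐ x * (y * z))
| ax_mulC G (x y : term G N) : RCA0w (x * y ≐ y * x)
| ax_mul1 G (x : term G N) : RCA0w (x * one ≐ x)
| ax_mul0 G (x : term G N) : RCA0w (x * zero ≐ zero)
| ax_mulD G (x y z : term G N) : RCA0w (x * (y + z) ≐ x * y + x * z)
| ax_lt_irr G (x : term G N) : RCA0w (¬ (x < x))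
| ax_lt_trans G (x y z : term G N) : RCA0w (x < y ⟶ y < z ⟶ x < z)
| ax_lt_total G (x y : term G N) : RCA0w (x < y ∨ x ≐ y ∨ y < x)
| ax_lt_add G (x y z : term G N) : RCA0w (x < y ⟶ x + z < y + z)
| ax_lt_mul G (x y z : term G N) : RCA0w (zero < z ⟶ x < y ⟶ x * z < y * z)
| ax_lt01 G : RCA0w (G := G) (zero < one)
| ax_Pi G r t (x : term G r) (y : term G t) : RCA0w (eqt (Pi r t · x · y) x)
| ax_Sigma G r s t (x : term G (r ⇒ s ⇒ t)) (y : term G (r ⇒ s)) (z : term G r) :
    RCA0w (eqt (Sigma r s t · x · y · z) (x · z · (y · z)))
| ax_Rec0 G (f : term G (N ⇒ N ⇒ N)) (m : term G N) :
    RCA0w (Rec · f · m · zero ≐ m)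
| ax_RecS G (f : term G (N ⇒ N ⇒ N)) (m n : term G N) :
    RCA0w (Rec · f · m · (n + one) ≐ f · n · (Rec · f · m · n))
| ax_ext G r t (x y : term G r) (F : term G (r ⇒ t)) :
    RCA0w (eqt x y ⟶ eqt (F · x) (F · y))
| ax_ind G (A : fm (N :: G)) : qf A ->
    RCA0w (inst A zero ⟶ All N (A ⟶ inst_succ A) ⟶ All N A)
| ax_QFAC10 G (A : fm (N :: T1 :: G)) : qf A -> RCA0w (QF_AC A).

Definition mu2 G : fm G :=
  ∃' mu ∶ T2, ∀' f ∶ T1,
    ((∃' n ∶ N, ↑f · ↑n ≐ zero) ⟶
       (↑f · (↑mu · ↑f) ≐ zero ∧
        ∀' i ∶ N, ↑i < ↑mu · ↑f ⟶ ¬ (↑f · ↑i ≐ zero))) ∧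
    ((∀' n ∶ N, ¬ (↑f · ↑n ≐ zero)) ⟶ ↑mu · ↑f ≐ zero).

Inductive ACA0w : theory :=
| ACA0w_RCA G (A : fm G) : RCA0w A -> ACA0w A
| ACA0w_mu G : ACA0w (mu2 G).

(* Sets and relations are 0/1-valued functionals. *)
Definition IsSet G s (X : term G (s ⇒ N)) : fm G :=
  ∀' z ∶ s, (↑X · ↑z ≐ zero ∨ ↑X · ↑z ≐ one).
Definition IsRel G s t (R : term G (s ⇒ t ⇒ N)) : fm G :=
  ∀' y ∶ s, ∀' z ∶ t, (↑R · ↑y · ↑z ≐ zero ∨ ↑R · ↑y · ↑z ≐ one).
Notation "z ∈ X" := (Eq (App X z) one) (at level 70) : fm_scope.

Definition Delta_CA G : fm G :=
  ∀' Y ∶ (T1 ⇒ N ⇒ N), ∀' Z ∶ (T1 ⇒ N ⇒ N)%ty,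
    (∀' n ∶ N, ((∃' f ∶ T1, ↑Y · ↑f · ↑n ≐ zero) ⟷
                (∀' g ∶ T1, ↑Z · ↑g · ↑n ≐ zero))) ⟶
    ∃' X ∶ T1, (IsSet ↑X ∧
      ∀' n ∶ N, (↑n ∈ ↑X ⟷ ∃' f ∶ T1, ↑Y · ↑f · ↑n ≐ zero)).

Inductive ACA0w_Delta_CA : theory :=
| ACA0w_Delta_CA_ACA G (A : fm G) : ACA0w A -> ACA0w_Delta_CA A
| ACA0w_Delta_CA_Delta G : ACA0w_Delta_CA (Delta_CA G).

(* A rational expression (pos - neg) / den, the intended den being positive. *)
Record rexp (G : list ty) := Rexp { pos : term G N; neg : term G N; den : term G N }.

Definition qlift G D (e : extends G D) (q : rexp G) : rexp D :=
  Rexp (lift (pos q)) (lift (neg q)) (lift (den q)).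
Arguments qlift {G D e} q.
Definition qadd G (p q : rexp G) : rexp G :=
  Rexp (pos p * den q + pos q * den p) (neg p * den q + neg q * den p) (den p * den q).
Definition qopp G (q : rexp G) : rexp G := Rexp (neg q) (pos q) (den q).
Definition qsub G (p q : rexp G) : rexp G := qadd p (qopp q).
Definition qlt G (p q : rexp G) : fm G :=
  pos p * den q + neg q * den p < pos q * den p + neg p * den q.
Definition qle G (p q : rexp G) : fm G :=
  qlt p q ∨ pos p * den q + neg q * den p ≐ pos q * den p + neg p * den q.
(* |p| < q and |p| <= q *)
Definition qabslt G (p q : rexp G) : fm G := qlt p q ∧ qlt (qopp p) q.
Definition qabsle G (p q : rexp G) : fm G := qle p q ∧ qle (qopp p) q.

Definition two G : term G N := one + one.
Arguments two {G}.
Definition pow2 G (n : term G N) : term G N :=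
  Rec · (Pi (N ⇒ N) N · (Cst Cmul · two)) · one · n.
(* 2^{-n} and 2^{-n+1} *)
Definition qexp G (n : term G N) : rexp G := Rexp one zero (pow2 n).
Definition qexp2 G (n : term G N) : rexp G := Rexp two zero (pow2 n).

(* An injective, non-surjective pairing: not every number is a code. *)
Definition pair G (i j : term G N) : term G N := (i + j) * (i + j) + i.

(* The number c codes the rational (p - n) / (d + 1) when c = ((p, n), d). *)
Definition decode G (c : term G N) (A : rexp (N :: N :: N :: G) -> fm (N :: N :: N :: G)) :
  fm G :=
  ∃' p ∶ N, ∃' n ∶ N, ∃' d ∶ N,
    (↑c ≐ pair (pair ↑p ↑n) ↑d ∧ A (Rexp ↑p ↑n (↑d + one))).

Definition IsRat G (c : term G N) : fm G := decode c (fun _ => ¬ Bot).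

(* |q_a - q_b| < 2^{-n} *)
Definition rat_close G (a b n : term G N) : fm G :=
  decode a (fun qa => decode ↑b (fun qb =>
    qabslt (qsub (qlift qa) qb) (qexp ↑n))).

Definition IsReal G (x : term G T1) : fm G :=
  (∀' n ∶ N, IsRat (↑x · ↑n)) ∧
  ∀' n ∶ N, ∀' i ∶ N, rat_close (↑x · ↑n) (↑x · (↑n + ↑i)) ↑n.

(* x <_R y: for some n, x_n + 2^{-n+1} < y_n *)
Definition real_lt G (x y : term G T1) : fm G :=
  ∃' n ∶ N, decode (↑x · ↑n) (fun qx => decode (↑y · ↑n) (fun qy =>
    qlt (qadd (qlift qx) (qexp2 ↑n)) qy)).

(* The rational with code c as a real number: a constant sequence. *)
Definition real_of_rat G (c : term G N) : term G T1 := Pi N N · c.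

(* |x - q_c| <= 2^{-k}: since n |-> |x_n - q_c| represents |x - q_c|, this is
   x' <=_R y', i.e. x'_n <= y'_n + 2^{-n+1} for all n, for that sequence x' and
   the constant sequence y' with value 2^{-k}. *)
Definition real_near G (x : term G T1) (c k : term G N) : fm G :=
  ∀' n ∶ N, decode (↑x · ↑n) (fun qx => decode ↑c (fun qc =>
    qabsle (qsub (qlift qx) qc) (qadd (qexp ↑k) (qexp2 ↑n)))).

Definition directed G (D : term G T2) (R : term G (T1 ⇒ T1 ⇒ N)) : fm G :=
  (∃' d ∶ T1, ↑d ∈ ↑D) ∧
  (∀' x ∶ T1, ∀' y ∶ T1, ∀' z ∶ T1,
     ↑x ∈ ↑D ⟶ ↑y ∈ ↑D ⟶ ↑z ∈ ↑D ⟶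
     ↑R · ↑x · ↑y ≐ one ⟶ ↑R · ↑y · ↑z ≐ one ⟶ ↑R · ↑x · ↑z ≐ one) ∧
  (∀' x ∶ T1, ↑x ∈ ↑D ⟶ ↑R · ↑x · ↑x ≐ one) ∧
  (∀' x ∶ T1, ∀' y ∶ T1, ↑x ∈ ↑D ⟶ ↑y ∈ ↑D ⟶
     ∃' z ∶ T1, (↑z ∈ ↑D ∧ ↑R · ↑x · ↑z ≐ one ∧ ↑R · ↑y · ↑z ≐ one)).

(* S is a net of (codes of) rationals indexed by D directed by R. *)
Definition rat_net G (D : term G T2) (R : term G (T1 ⇒ T1 ⇒ N)) (S : term G T2) : fm G :=
  IsSet D ∧ IsRel R ∧ directed D R ∧
  ∀' d ∶ T1, ↑d ∈ ↑D ⟶ IsRat (↑S · ↑d).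

Definition in_sep_closed G (D S : term G T2) (x : term G T1) : fm G :=
  ∀' k ∶ N, ∃' d ∶ T1, (↑d ∈ ↑D ∧ real_near ↑x (↑S · ↑d) ↑k).

(* The sequence of open intervals (q_{a n}, q_{b n}); intervals with
   q_{b n} <= q_{a n} are empty. *)
Definition rat_seq G (a : term G T1) : fm G := ∀' n ∶ N, IsRat (↑a · ↑n).
Definition in_RM_open G (a b x : term G T1) : fm G :=
  ∃' n ∶ N, (real_lt (real_of_rat (↑a · ↑n)) ↑x ∧ real_lt ↑x (real_of_rat (↑b · ↑n))).

Definition CLO G : fm G :=
  ∀' D ∶ T2, ∀' R ∶ (T1 ⇒ T1 ⇒ N), ∀' S ∶ T2,
    rat_net ↑D ↑R ↑S ⟶
    ∃' a ∶ T1, ∃' b ∶ T1,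
      (rat_seq ↑a ∧ rat_seq ↑b ∧
       ∀' x ∶ T1, IsReal ↑x ⟶
         (in_sep_closed ↑D ↑S ↑x ⟷ ¬ in_RM_open ↑a ↑b ↑x)).

Definition RANGE G : fm G :=
  ∀' H ∶ T2, ∃' X ∶ T1,
    (IsSet ↑X ∧ ∀' n ∶ N, (↑n ∈ ↑X ⟷ ∃' f ∶ T1, ↑H · ↑f ≐ ↑n)).

(* Main.v *)
Require Import Defs.
From Stdlib Require Import List Setoid Morphisms Ring.
Import ListNotations.

Set Implicit Arguments.
Unset Strict Implicit.

(** Given a functional [H] of type 2, take the net of rationals indexed by all
    of Baire space, with the total relation as (trivially directed) order, whose
    value at [f] is the natural number [H(f)].  Distinct naturals are at distance
    at least 1, so a natural [n] lies in the separable closure iff it is a value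
    of [H] ([range_net_closure]).  [CLO] presents this closure as the complement
    of a sequence of rational intervals, and membership of the real [n] in that
    complement is an arithmetical formula: it quantifies over numbers only.
    Hence Feferman's [mu] decides it, uniformly in [n], which is arithmetical
    comprehension ([arith_comprehension]), and the set obtained is the range.

    The derivation is built inside the calculus.  Three tools keep this short.
    - Bracket abstraction [lam], with its beta rule [lam_beta] up to extensional
      equality; that rule is stated for the bound variable itself, so its
      induction involves no substitution.
    - An arithmetic in which an inequality [x < y] is replaced by an equation
      [y = x + k + 1] whose witness [k] is a term (truncated subtraction).  Case
      distinctions on order then yield equations, and contradictions arise from
      [x = x + k + 1]; what remains is polynomial identities.
    - For every arithmetical formula a term that vanishes exactly when the
      formula holds, by recursion on the formula ([arith_decision]): [mu] serves
      the quantifiers, and implication is a conditional on zero.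

    In the last part the terms put into [CLO] are built from explicit variables,
    so that substitution and weakening are decided by conversion. *)

(** * Renaming and substitution *)

Lemma var_case G s (P : forall t, var (s :: G) t -> Prop) :
  P s vz -> (forall t (y : var G t), P t (vs y)) -> forall t (x : var (s :: G) t), P t x.
Proof.
intros Pz Ps t x; revert P Pz Ps.
refine (match x in var G' t' return
  match G' as L return var L t' -> Prop with
  | [] => fun _ => True
  | s' :: G0 => fun x' => forall P : (forall t, var (s' :: G0) t -> Prop),
      P s' vz -> (forall t (y : var G0 t), P t (vs y)) -> P t' x'
  end x with vz => _ | vs y => _ end); auto.
Qed.

Lemma ren_ren G D E (r : renaming G D) (r' : renaming D E) t (u : term G t) :
  ren r' (ren r u) = ren (fun t x => r' t (r t x)) u.
Proof. induction u; simpl; congruence. Qed.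

Lemma sub_ren G D E (r : renaming G D) (f : substitution D E) t (u : term G t) :
  sub f (ren r u) = sub (fun t x => f t (r t x)) u.
Proof. induction u; simpl; congruence. Qed.

Lemma sub_var G D (r : renaming G D) (f : substitution G D) t (u : term G t) :
  (forall t x, f t x = Var (r t x)) -> sub f u = ren r u.
Proof. intros E; induction u; simpl; congruence. Qed.

Lemma sub_id G (f : substitution G G) t (u : term G t) :
  (forall t x, f t x = Var x) -> sub f u = u.
Proof. intros E; induction u; simpl; congruence. Qed.

Lemma ren_up_wk G D s (r : renaming G D) t (u : term G t) :
  ren (ren_up (s := s) r) (wk _ u) = wk _ (ren r u).
Proof. unfold wk; rewrite !ren_ren; reflexivity. Qed.

Lemma sub_up_wk G D s (f : substitution G D) t (u : term G t) :
  sub (sub_up (s := s) f) (wk _ u) = wk _ (sub f u).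
Proof.
unfold wk; rewrite sub_ren.
change (sub (fun t x => wk s (f t x)) u = wk s (sub f u)).
induction u as [t x|t c|t' t a IHa b IHb]; [reflexivity..|].
simpl; rewrite IHa, IHb; reflexivity.
Qed.

Lemma sub_scons_wk G D s (v : term D s) (f : substitution G D) t (u : term G t) :
  sub (scons v f) (wk _ u) = sub f u.
Proof. unfold wk; rewrite sub_ren; reflexivity. Qed.

Lemma sub_wk G s (v : term G s) t (u : term G t) :
  sub (scons v (fun _ => Var)) (wk _ u) = u.
Proof. rewrite sub_scons_wk; apply sub_id; reflexivity. Qed.

Lemma sub_succ_wk G t (u : term G t) :
  sub (scons (Var vz + one) (fun _ x => Var (vs x))) (wk _ u) = wk N u.
Proof. rewrite sub_scons_wk; apply sub_var; reflexivity. Qed.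

(** A substitution that undoes a renaming; instantiating a weakened quantifier at
    its own variable, [inst_wk_vz], is of this kind. *)
Lemma subf_renf_id G D (A : fm G) : forall (r : renaming G D) (f : substitution D G),
  (forall t x, f t (r t x) = Var x) -> subf f (renf r A) = A.
Proof.
revert D; induction A as [G u v|G u v|G|G A IHA B IHB|G s A IHA]; intros D r f E; simpl.
1,2: rewrite !sub_ren, !sub_id by exact E; reflexivity.
- reflexivity.
- rewrite IHA, IHB by exact E; reflexivity.
- f_equal; apply IHA.
  intros t x; revert t x; apply var_case; [reflexivity|].
  intros t y; simpl; rewrite E; reflexivity.
Qed.

Lemma inst_wk_vz G s (A : fm (s :: G)) :
  inst (renf (ren_up (fun _ => vs)) A) (Var vz) = A.
Proof. apply subf_renf_id; apply var_case; reflexivity. Qed.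

Lemma renf_eqt G D (r : renaming G D) t (u v : term G t) :
  renf r (eqt u v) = eqt (ren r u) (ren r v).
Proof.
revert G D r u v; induction t as [|s _ t IH]; intros G D r u v; [reflexivity|].
simpl; unfold all_; simpl; rewrite IH; simpl.
do 3 f_equal; f_equal; apply ren_up_wk.
Qed.

Lemma subf_eqt G D (f : substitution G D) t (u v : term G t) :
  subf f (eqt u v) = eqt (sub f u) (sub f v).
Proof.
revert G D f u v; induction t as [|s _ t IH]; intros G D f u v; [reflexivity|].
simpl; unfold all_; simpl; rewrite IH; simpl.
do 3 f_equal; f_equal; apply sub_up_wk.
Qed.

Lemma inst_eqt G s t (u v : term G (s ⇒ t)) (w : term G s) :
  inst (eqt (wk _ u · Var vz) (wk _ v · Var vz)) w = eqt (u · w) (v · w).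
Proof. unfold inst; rewrite subf_eqt; simpl; rewrite !sub_wk; reflexivity. Qed.

(** * Classical natural deduction *)

Notation "T ; H ⊢ A" := (@prov T _ H A%fm)
  (at level 99, H at level 98, A at level 98, format "T ;  H  ⊢  A").

Section Logic.
Context (T : theory).

Lemma weaken G (H H' : list (fm G)) A : incl H H' -> T; H ⊢ A -> T; H' ⊢ A.
Proof.
intros I P; revert H' I.
induction P; intros H' I.
- now apply p_ax.
- apply p_hyp; auto.
- apply p_impI, IHP; intros B' [<-|h]; simpl; auto.
- eapply p_impE; eauto.
- apply p_raa, IHP; intros B' [<-|h]; simpl; auto.
- apply p_allI, IHP; now apply incl_map.
- apply p_allE; auto.
- apply p_refl.
- eapply p_leibniz; eauto.
Qed.

Context {G : list ty}.
Implicit Types (H : list (fm G)) (A B C : fm G).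

Lemma hyp0 H A : T; A :: H ⊢ A.
Proof. apply p_hyp; now left. Qed.

Lemma hyp1 H A B : T; A :: B :: H ⊢ B.
Proof. apply p_hyp; right; now left. Qed.

Lemma weaken1 H A B : T; H ⊢ B -> T; A :: H ⊢ B.
Proof. apply weaken, incl_tl, incl_refl. Qed.

Lemma cut H A C : T; H ⊢ A -> T; A :: H ⊢ C -> T; H ⊢ C.
Proof. intros a c; eapply p_impE; [apply p_impI, c|exact a]. Qed.

Lemma botE H C : T; H ⊢ Bot -> T; H ⊢ C.
Proof. intros b; now apply p_raa, weaken1. Qed.

Lemma negE H A C : T; H ⊢ ¬ A -> T; H ⊢ A -> T; H ⊢ C.
Proof. intros n a; apply botE; eapply p_impE; [exact n|exact a]. Qed.

Lemma em H A C : T; A :: H ⊢ C -> T; (¬ A) :: H ⊢ C -> T; H ⊢ C.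
Proof.
intros a n; apply p_raa.
apply (@cut _ (¬ A)).
- apply p_impI. apply (@negE _ C); [apply weaken1, hyp0|].
  eapply weaken; [|exact a]. intros x [<-|h]; simpl; auto.
- apply (@negE _ C); [apply weaken1, hyp0|].
  eapply weaken; [|exact n]. intros x [<-|h]; simpl; auto.
Qed.

Lemma andI H A B : T; H ⊢ A -> T; H ⊢ B -> T; H ⊢ A ∧ B.
Proof.
intros a b; apply p_impI.
eapply p_impE; [eapply p_impE; [apply hyp0|]|]; now apply weaken1.
Qed.

Lemma andE1 H A B : T; H ⊢ A ∧ B -> T; H ⊢ A.
Proof.
intros ab; apply p_raa; eapply p_impE; [apply weaken1, ab|].
apply p_impI; apply (@negE _ A); [apply weaken1, hyp0|apply hyp0].
Qed.

Lemma andE2 H A B : T; H ⊢ A ∧ B -> T; H ⊢ B.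
Proof.
intros ab; apply p_raa; eapply p_impE; [apply weaken1, ab|].
apply p_impI; apply weaken1, hyp0.
Qed.

Lemma orI1 H A B : T; H ⊢ A -> T; H ⊢ A ∨ B.
Proof. intros a; apply p_impI; apply (@negE _ A); [apply hyp0|now apply weaken1]. Qed.

Lemma orI2 H A B : T; H ⊢ B -> T; H ⊢ A ∨ B.
Proof. intros b; now apply p_impI, weaken1. Qed.

(** A case distinction in continuation style: each branch works over an
    arbitrary larger list [H'].  Facts already derived over [H] are transported
    to [H'] by the tactic [up] below, so that a derivation reads like a proof
    in the ambient logic. *)
Lemma em_cases H A C :
  (forall H', incl H H' -> T; H' ⊢ A -> T; H' ⊢ C) ->
  (forall H', incl H H' -> T; H' ⊢ ¬ A -> T; H' ⊢ C) -> T; H ⊢ C.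
Proof.
intros a n; apply (@em _ A); [apply a|apply n];
  try apply hyp0; apply incl_tl, incl_refl.
Qed.

Lemma or_cases H A B C : T; H ⊢ A ∨ B ->
  (forall H', incl H H' -> T; H' ⊢ A -> T; H' ⊢ C) ->
  (forall H', incl H H' -> T; H' ⊢ B -> T; H' ⊢ C) -> T; H ⊢ C.
Proof.
intros o a b; apply (@em_cases _ A); [exact a|].
intros H' I n; apply b; [exact I|].
eapply p_impE; [eapply weaken; [exact I|exact o]|exact n].
Qed.

Lemma impI_gen H A B :
  (forall H', incl H H' -> T; H' ⊢ A -> T; H' ⊢ B) -> T; H ⊢ A ⟶ B.
Proof. intros h; apply p_impI, h; [apply incl_tl, incl_refl|apply hyp0]. Qed.

Lemma iffI H A B :
  (forall H', incl H H' -> T; H' ⊢ A -> T; H' ⊢ B) ->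
  (forall H', incl H H' -> T; H' ⊢ B -> T; H' ⊢ A) -> T; H ⊢ A ⟷ B.
Proof. intros; apply andI; now apply impI_gen. Qed.

Lemma iffE1 H A B : T; H ⊢ A ⟷ B -> T; H ⊢ A -> T; H ⊢ B.
Proof. intros ab; exact (p_impE (andE1 ab)). Qed.

Lemma iffE2 H A B : T; H ⊢ A ⟷ B -> T; H ⊢ B -> T; H ⊢ A.
Proof. intros ab; exact (p_impE (andE2 ab)). Qed.

Lemma exI H s (A : fm (s :: G)) (u : term G s) : T; H ⊢ inst A u -> T; H ⊢ Exi A.
Proof.
intros a; apply p_impI.
apply (@negE _ (inst A u)); [|now apply weaken1].
apply (p_allE (A := Neg A) u), hyp0.
Qed.

(** Here the context grows.  Members of [H] are carried along, derived
    facts are not; later proofs therefore enter the scope of an existential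
    quantifier with everything they need among the hypotheses. *)
Lemma exE H s (A : fm (s :: G)) C :
  T; H ⊢ Exi A -> T; A :: map (@wkf G s) H ⊢ wkf s C -> T; H ⊢ C.
Proof.
intros e c; apply p_raa; eapply p_impE; [apply weaken1, e|].
apply p_allI, p_impI.
eapply p_impE; [apply p_hyp; right; left; reflexivity|].
eapply weaken; [|exact c]. intros x [<-|h]; simpl; auto.
Qed.

End Logic.

Ltac transport I := repeat match type of I with
  | incl ?H ?H' => match goal with
    | h : @prov _ _ H _ |- _ => apply (weaken I) in h
    | h : In _ H |- _ => apply I in h
    end
  end; clear I.

(** [up p] introduces a larger hypothesis list together with the new fact [p]
    and moves all known derivations to that list; [up k p] first introduces a
    witness [k]. *)
Tactic Notation "up" simple_intropattern(p) :=
  let H' := fresh "H" in let I := fresh "I" in intros H' I p; transport I.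
Tactic Notation "up" simple_intropattern(k) simple_intropattern(p) :=
  let H' := fresh "H" in let I := fresh "I" in intros H' k I p; transport I.

(** * Numerical and extensional equality *)

Section Equality.
Context (T : theory) (G : list ty).
Implicit Types (H : list (fm G)).

Definition eqn H (u v : term G N) := T; H ⊢ u ≐ v.

#[export] Instance eqn_equivalence H : Equivalence (eqn H).
Proof.
split.
- intros u; apply p_refl.
- intros u v e.
  pose proof (@p_leibniz T _ H (Eq (Var vz) (wk _ u)) _ _ e) as P.
  unfold inst in P; simpl in P; rewrite !sub_wk in P. apply P, p_refl.
- intros u v w e e'.
  pose proof (@p_leibniz T _ H (Eq (wk _ u) (Var vz)) _ _ e') as P.
  unfold inst in P; simpl in P; rewrite !sub_wk in P. apply P, e.
Qed.

Lemma eq_sym H u v : T; H ⊢ u ≐ v -> T; H ⊢ v ≐ u.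
Proof. exact (@symmetry _ (eqn H) _ u v). Qed.

Lemma eq_trans H u v w : T; H ⊢ u ≐ v -> T; H ⊢ v ≐ w -> T; H ⊢ u ≐ w.
Proof. exact (@transitivity _ (eqn H) _ u v w). Qed.

Lemma app_congr H (f : term G T1) u v : T; H ⊢ u ≐ v -> T; H ⊢ f · u ≐ f · v.
Proof.
intros e.
pose proof (@p_leibniz T _ H (Eq (wk _ f · wk _ u) (wk _ f · Var vz)) _ _ e) as P.
unfold inst in P; simpl in P; rewrite !sub_wk in P. apply P, p_refl.
Qed.

Lemma app_congr2 H (f : term G (N ⇒ N ⇒ N)) u v u' v' :
  T; H ⊢ u ≐ v -> T; H ⊢ u' ≐ v' -> T; H ⊢ f · u · u' ≐ f · v · v'.
Proof.
intros e e'. eapply eq_trans; [apply app_congr, e'|].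
pose proof (@p_leibniz T _ H (Eq (wk _ f · wk _ u · wk _ v') (wk _ f · Var vz · wk _ v')) _ _ e) as P.
unfold inst in P; simpl in P; rewrite !sub_wk in P. apply P, p_refl.
Qed.

Lemma lt_congr H u v u' v' :
  T; H ⊢ u ≐ v -> T; H ⊢ u' ≐ v' -> T; H ⊢ u < u' -> T; H ⊢ v < v'.
Proof.
intros e e' l.
pose proof (@p_leibniz T _ H (Lt (Var vz) (wk _ u')) _ _ e) as P.
pose proof (@p_leibniz T _ H (Lt (wk _ v) (Var vz)) _ _ e') as Q.
unfold inst in P, Q; simpl in P, Q; rewrite !sub_wk in P, Q. auto.
Qed.

End Equality.

Section Ext.
Context (T : theory) (RCA : forall G (A : fm G), RCA0w A -> T G A).

Lemma ax G (H : list (fm G)) A : RCA0w A -> T; H ⊢ A.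
Proof. intros a; now apply p_ax, RCA. Qed.

Lemma eqt_app G (H : list (fm G)) s t (u v : term G (s ⇒ t)) (w : term G s) :
  T; H ⊢ eqt u v -> T; H ⊢ eqt (u · w) (v · w).
Proof. intros e; rewrite <- inst_eqt; exact (p_allE w e). Qed.

(** The induction passes under the quantifier of [eqt]; as an implication the claim
    can be used there for arbitrary hypotheses. *)
Lemma eqt_trans_imp t G (H : list (fm G)) (u v w : term G t) :
  T; H ⊢ eqt u v ⟶ eqt v w ⟶ eqt u w.
Proof.
revert G H u v w; induction t as [|s _ t IH]; intros G H u v w.
- do 2 apply p_impI; simpl.
  exact (eq_trans (weaken1 _ (hyp0 _ _ _)) (hyp0 _ _ _)).
- do 2 apply p_impI; apply p_allI.
  eapply p_impE; [eapply p_impE; [apply IH with (v := ↑v · Var vz)|]|].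
  + change (T; map (wkf s) (eqt v w :: eqt u v :: H) ⊢
     eqt (wk _ u · Var vz) (wk _ v · Var vz)).
    apply eqt_app. apply p_hyp. right; left. apply renf_eqt.
  + change (T; map (wkf s) (eqt v w :: eqt u v :: H) ⊢
     eqt (wk _ v · Var vz) (wk _ w · Var vz)).
    apply eqt_app. apply p_hyp. left. apply renf_eqt.
Qed.

Lemma eqt_trans t G (H : list (fm G)) (u v w : term G t) :
  T; H ⊢ eqt u v -> T; H ⊢ eqt v w -> T; H ⊢ eqt u w.
Proof. intros a b. exact (p_impE (p_impE (eqt_trans_imp _ _ _ _) a) b). Qed.

Lemma eqt_arg G (H : list (fm G)) s t (f : term G (s ⇒ t)) (u v : term G s) :
  T; H ⊢ eqt u v -> T; H ⊢ eqt (f · u) (f · v).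
Proof. intros e. eapply p_impE; [|exact e]. apply ax, ax_ext. Qed.

End Ext.

(** * Bracket abstraction *)

Definition lam_var G s t (x : var (s :: G) t) : term G (s ⇒ t) :=
  match x in var G' t' return
    match G' with [] => unit | s' :: G0 => term G0 (s' ⇒ t') end
  with
  | @vz _ s => Sigma s (s ⇒ s) s · Pi s (s ⇒ s) · Pi s s
  | @vs _ s t y => Pi t s · Var y
  end.

Fixpoint lam G s t (b : term (s :: G) t) : term G (s ⇒ t) :=
  match b in term _ t return term G (s ⇒ t) with
  | Var x => lam_var x
  | @Cst _ t c => Pi t s · Cst c
  | @App _ t' t f a => Sigma s t' t · lam f · lam a
  end.

(** The argument is the bound variable, in the context where it is bound.  Closing
    universally and instantiating gives the rule for any argument, see [lam_app]. *)
Lemma lam_beta T (RCA : forall G (A : fm G), RCA0w A -> T G A)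
  G s t (b : term (s :: G) t) H :
  T; H ⊢ eqt (wk _ (lam b) · Var vz) b.
Proof.
induction b as [t x|t c|t' t f IHf a IHa].
- revert t x; apply var_case; simpl.
  + eapply eqt_trans; [apply (ax RCA), ax_Sigma|]. apply (ax RCA), ax_Pi.
  + intros t y; apply (ax RCA), ax_Pi.
- apply (ax RCA), ax_Pi.
- simpl. eapply eqt_trans; [apply (ax RCA), ax_Sigma|].
  eapply eqt_trans; [apply eqt_app, IHf|]. apply (eqt_arg RCA), IHa.
Qed.

(** * Arithmetic *)

(** The ring solver recognises operations only as applied constants, so terms are
    folded to these two before it is called. *)
Definition tadd G (u v : term G N) : term G N := u + v.
Definition tmul G (u v : term G N) : term G N := u * v.

Definition prd G (x : term G N) : term G N := Rec · Pi N N · zero · x.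
Definition monus G (x y : term G N) : term G N :=
  Rec · (Pi (N ⇒ N) N · (Rec · Pi N N · zero)) · x · y.

(** [ifz x y] is [y] if [x] is zero and zero otherwise. *)
Definition ifz G (x y : term G N) : term G N :=
  Rec · (Pi (N ⇒ N) N · (Pi N N · zero)) · y · x.

(** [toalg] folds all equations in sight; [sring] proves a polynomial identity.
    The identity is proved over the empty list of hypotheses and then weakened,
    since a ring structure is registered for one list whereas case distinctions
    keep changing the list. *)
Ltac alg t := match t with
  | App (App (Cst Cadd) ?u) ?v => let u := alg u in let v := alg v in constr:(tadd u v)
  | App (App (Cst Cmul) ?u) ?v => let u := alg u in let v := alg v in constr:(tmul u v)
  | @two ?G => constr:(tadd (@Cst G N Cone) (@Cst G N Cone))
  | _ => t
  end.
Ltac toalg := cbn [Defs.pos Defs.neg Defs.den qsub qadd qopp] in *;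
  repeat match goal with
  | h : prov ?T ?H (Eq ?u ?v) |- _ =>
      let u := alg u in let v := alg v in change (eqn T H u v) in h
  | |- prov ?T ?H (Eq ?u ?v) =>
      let u := alg u in let v := alg v in change (eqn T H u v)
  end.
Ltac sring := toalg; match goal with |- @eqn ?T ?G ?H ?u ?v =>
  apply (@weaken T G [] H (Eq u v) (incl_nil_l _)); change (eqn T [] u v) end; ring.

Section Arithmetic.
Context (T : theory) (RCA : forall G (A : fm G), RCA0w A -> T G A).

Lemma semiring G (H : list (fm G)) :
  semi_ring_theory zero one (@tadd G) (@tmul G) (eqn T H).
Proof.
assert (C : forall x y : term G N, eqn T H (x + y) (y + x)) by (intros; apply (ax RCA), ax_addC).
assert (M : forall x y : term G N, eqn T H (x * y) (y * x)) by (intros; apply (ax RCA), ax_mulC).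
split; unfold tadd, tmul; intros.
- etransitivity; [apply C|]. apply (ax RCA), ax_add0.
- apply C.
- symmetry. apply (ax RCA), ax_addA.
- etransitivity; [apply M|]. apply (ax RCA), ax_mul1.
- etransitivity; [apply M|]. apply (ax RCA), ax_mul0.
- apply M.
- symmetry. apply (ax RCA), ax_mulA.
- etransitivity; [apply M|]. etransitivity; [apply (ax RCA), ax_mulD|].
  apply (app_congr2 (Cst Cadd)); apply M.
Qed.

#[local] Instance tadd_proper G (H : list (fm G)) :
  Proper (eqn T H ==> eqn T H ==> eqn T H) (@tadd G).
Proof. intros x y e x' y' e'; exact (app_congr2 (Cst Cadd) e e'). Qed.

#[local] Instance tmul_proper G (H : list (fm G)) :
  Proper (eqn T H ==> eqn T H ==> eqn T H) (@tmul G).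
Proof. intros x y e x' y' e'; exact (app_congr2 (Cst Cmul) e e'). Qed.

Lemma semiring_ext G (H : list (fm G)) : sring_eq_ext (@tadd G) (@tmul G) (eqn T H).
Proof. split; exact _. Qed.

(** Inductions alternate with sections that register the ring: a step of an
    induction over the context [G] takes place over [N :: G], so its lemma has to
    be available for all contexts. *)
Lemma succ_induction G (H : list (fm G)) (A : fm (N :: G)) (u : term G N) : qf A ->
  T; H ⊢ inst A zero -> T; A :: map (@wkf G N) H ⊢ inst_succ A -> T; H ⊢ inst A u.
Proof.
intros q a s. apply p_allE. eapply p_impE; [eapply p_impE; [apply (ax RCA), ax_ind, q|exact a]|].
apply p_allI, p_impI, s.
Qed.

Lemma rec_succ G (H : list (fm G)) (f : term G (N ⇒ N ⇒ N)) m n :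
  T; H ⊢ Rec · f · m · (n + one) ≐ f · n · (Rec · f · m · n).
Proof. apply (ax RCA), ax_RecS. Qed.

Lemma const_beta G (H : list (fm G)) s (x : term G N) (y : term G s) : T; H ⊢ Pi N s · x · y ≐ x.
Proof. exact (ax RCA H (ax_Pi x y)). Qed.

(** The step functions of the recursions in use ignore their counter. *)
Lemma const_step G (H : list (fm G)) (g : term G T1) (n m : term G N) :
  T; H ⊢ Pi (N ⇒ N) N · g · n · m ≐ g · m.
Proof.
exact (eqt_app (s := N) (t := N) m (ax RCA H (ax_Pi g n))).
Qed.

Lemma prd_zero G (H : list (fm G)) : T; H ⊢ prd zero ≐ (zero : term G N).
Proof. apply (ax RCA), ax_Rec0. Qed.

Lemma prd_succ G (H : list (fm G)) (x : term G N) : T; H ⊢ prd (x + one) ≐ x.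
Proof.
apply (eq_trans (rec_succ _ _ _ _)).
apply const_beta.
Qed.

Lemma monus_zero G (H : list (fm G)) (x : term G N) : T; H ⊢ monus x zero ≐ x.
Proof. apply (ax RCA), ax_Rec0. Qed.

Lemma monus_succ G (H : list (fm G)) (x y : term G N) : T; H ⊢ monus x (y + one) ≐ prd (monus x y).
Proof.
apply (eq_trans (rec_succ _ _ _ _)).
apply const_step.
Qed.

Lemma ifz_zero G (H : list (fm G)) (x y : term G N) : T; H ⊢ x ≐ zero -> T; H ⊢ ifz x y ≐ y.
Proof.
intros e.
apply (eq_trans (app_congr _ e)).
apply (ax RCA), ax_Rec0.
Qed.

Lemma ifz_succ G (H : list (fm G)) (x y k : term G N) :
  T; H ⊢ x ≐ k + one -> T; H ⊢ ifz x y ≐ zero.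
Proof.
intros e.
apply (eq_trans (app_congr _ e)).
apply (eq_trans (rec_succ _ _ _ _)).
apply (eq_trans (const_step _ _ _ _)).
apply const_beta.
Qed.

Lemma pow2_zero G (H : list (fm G)) : T; H ⊢ pow2 zero ≐ (one : term G N).
Proof. apply (ax RCA), ax_Rec0. Qed.

Lemma pow2_succ G (H : list (fm G)) (n : term G N) : T; H ⊢ pow2 (n + one) ≐ two * pow2 n.
Proof.
apply (eq_trans (rec_succ _ _ _ _)).
apply const_step.
Qed.

Lemma lt_trans G (H : list (fm G)) (x y z : term G N) :
  T; H ⊢ x < y -> T; H ⊢ y < z -> T; H ⊢ x < z.
Proof. intros a b. eapply p_impE; [eapply p_impE; [apply (ax RCA), ax_lt_trans|exact a]|exact b]. Qed.

Lemma lt_irrefl G (H : list (fm G)) (x : term G N) C : T; H ⊢ x < x -> T; H ⊢ C.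
Proof. intros a. exact (negE _ (ax RCA H (ax_lt_irr x)) a). Qed.

Lemma lt_add G (H : list (fm G)) (x y z : term G N) : T; H ⊢ x < y -> T; H ⊢ x + z < y + z.
Proof. intros a. eapply p_impE; [apply (ax RCA), ax_lt_add|exact a]. Qed.

Section Solver.
Context (G : list ty).
Add Ring term_ring : (@semiring G []) (setoid (@eqn_equivalence T G []) (@semiring_ext G [])).

Implicit Types (H : list (fm G)).

Lemma lt_zero_one H : T; H ⊢ (zero : term G N) < one.
Proof. apply (ax RCA), ax_lt01. Qed.

Lemma lt_succ_pos H (x : term G N) : T; H ⊢ zero < x + one -> T; H ⊢ zero < (x + one) + one.
Proof.
intros a. apply (lt_trans a).
refine (lt_congr _ _ (lt_add (x + one) (lt_zero_one H))); sring.
Qed.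

Lemma pos_double H (x : term G N) : T; H ⊢ zero < x -> T; H ⊢ zero < two * x.
Proof.
intros a. apply (lt_trans a).
refine (lt_congr _ _ (lt_add x a)); sring.
Qed.

Lemma lt_succ H (x : term G N) : T; H ⊢ x < x + one.
Proof. refine (lt_congr _ _ (lt_add x (lt_zero_one H))); sring. Qed.

End Solver.

Lemma succ_pos G (H : list (fm G)) (u : term G N) : T; H ⊢ zero < u + one.
Proof.
apply (@succ_induction _ _ (zero < Var vz + one) u I).
- exact (lt_succ H zero).
- exact (lt_succ_pos (hyp0 _ _ _)).
Qed.

Lemma zero_or_succ G (H : list (fm G)) (u : term G N) : T; H ⊢ u ≐ zero ∨ u ≐ prd u + one.
Proof.
apply (@succ_induction _ _ (Var vz ≐ zero ∨ Var vz ≐ prd (Var vz) + one) u).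
- repeat split.
- apply orI1, p_refl.
- apply orI2. apply (app_congr2 (Cst Cadd)); [|apply p_refl].
  apply eq_sym, prd_succ.
Qed.

Lemma nat_cases G (H : list (fm G)) (u : term G N) C :
  (forall H', incl H H' -> T; H' ⊢ u ≐ zero -> T; H' ⊢ C) ->
  (forall H' k, incl H H' -> T; H' ⊢ u ≐ k + one -> T; H' ⊢ C) -> T; H ⊢ C.
Proof. intros z s. apply (or_cases (zero_or_succ H u)); [exact z|intros H'; apply s]. Qed.

Lemma pow2_pos G (H : list (fm G)) (n : term G N) : T; H ⊢ zero < pow2 n.
Proof.
apply (@succ_induction _ _ (zero < pow2 (Var vz)) n I).
- exact (lt_congr (p_refl _ _ _) (eq_sym (pow2_zero H)) (lt_zero_one H)).
- refine (lt_congr (p_refl _ _ _) (eq_sym (pow2_succ _ _)) _).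
  apply pos_double, hyp0.
Qed.

Section Solver.
Context (G : list ty).
Add Ring term_ring : (@semiring G []) (setoid (@eqn_equivalence T G []) (@semiring_ext G [])).
Implicit Types (H : list (fm G)).

(** Truncated subtraction has either reached zero, with [x] at most [y], or is the
    true difference.  This is quantifier-free and preserved by the recursion on
    [y], hence within reach of the induction axiom for each fixed [x]. *)
Definition monus_inv (x y : term G N) : fm G :=
  (monus x y ≐ zero ∧ ¬ (y < x)) ∨ monus x y + y ≐ x.

Lemma monus_inv_succ H (x y : term G N) : T; H ⊢ monus_inv x y -> T; H ⊢ monus_inv x (y + one).
Proof.
intros h; apply (or_cases h).
- up c. pose proof (andE1 c) as z; pose proof (andE2 c) as n.
  apply orI1, andI.
  + apply (eq_trans (monus_succ _ _ _)), (eq_trans (app_congr _ z)), prd_zero.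
  + apply impI_gen; up l. apply (negE _ n). exact (lt_trans (lt_succ _ _) l).
- up e. apply (@nat_cases _ _ (monus x y)).
  + up z. apply orI1, andI.
    * apply (eq_trans (monus_succ _ _ _)), (eq_trans (app_congr _ z)), prd_zero.
    * apply impI_gen; up l. apply (@lt_irrefl _ _ x).
      refine (lt_trans _ l). refine (lt_congr _ (p_refl _ _ _) (lt_succ _ y)).
      toalg. rewrite z in e. rewrite <- e. sring.
  + up k s. apply orI2.
    pose proof (eq_trans (monus_succ _ x y) (eq_trans (app_congr _ s) (prd_succ _ _))) as e'.
    toalg. rewrite e'. rewrite s in e. rewrite <- e. sring.
Qed.

Lemma monus_inv_zero H (x : term G N) : T; H ⊢ monus_inv x zero.
Proof.
apply orI2. pose proof (monus_zero H x) as e. toalg. rewrite e. sring.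
Qed.

End Solver.

Lemma monus_spec G (H : list (fm G)) (x y : term G N) : T; H ⊢ monus_inv x y.
Proof.
pose proof (@succ_induction _ H (monus_inv (wk _ x) (Var vz)) y) as P.
unfold inst, inst_succ, monus_inv, Or, And, Neg, monus in P; cbn -[wk] in P.
rewrite !sub_wk, !sub_succ_wk in P. apply P.
- repeat split.
- apply monus_inv_zero.
- exact (monus_inv_succ (x := wk _ x) (hyp0 _ _ _)).
Qed.

Section Solver.
Context (G : list ty).
Add Ring term_ring : (@semiring G []) (setoid (@eqn_equivalence T G []) (@semiring_ext G [])).
Implicit Types (H : list (fm G)).

(** The witness is a term: an existential formula would force a change of context. *)
Lemma lt_diff H (x y : term G N) :
  T; H ⊢ x < y -> T; H ⊢ y ≐ (x + prd (monus y x)) + one.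
Proof.
intros l; apply (or_cases (monus_spec H y x)).
- up c. exact (negE _ (andE2 c) l).
- up e. apply (or_cases (zero_or_succ _ (monus y x))).
  + up z. apply (@lt_irrefl _ _ x).
    refine (lt_congr (p_refl _ _ _) _ l).
    toalg. rewrite z in e. rewrite <- e. sring.
  + up s. set (k := prd (monus y x)) in *. toalg. rewrite s in e. rewrite <- e. sring.
Qed.

Lemma diff_lt H (x y k : term G N) : T; H ⊢ y ≐ (x + k) + one -> T; H ⊢ x < y.
Proof.
intros e. refine (lt_congr _ _ (lt_add x (succ_pos H k))); [sring|].
toalg. rewrite e. sring.
Qed.

Lemma no_excess H (x k : term G N) C : T; H ⊢ x ≐ (x + k) + one -> T; H ⊢ C.
Proof. intros e. exact (lt_irrefl _ (diff_lt e)). Qed.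

(** Every branch receives an equation, so that it can proceed by rewriting. *)
Lemma trichotomy H (x y : term G N) C :
  (forall H' k, incl H H' -> T; H' ⊢ y ≐ (x + k) + one -> T; H' ⊢ C) ->
  (forall H', incl H H' -> T; H' ⊢ x ≐ y -> T; H' ⊢ C) ->
  (forall H' k, incl H H' -> T; H' ⊢ x ≐ (y + k) + one -> T; H' ⊢ C) -> T; H ⊢ C.
Proof.
intros l e g.
assert (o : T; H ⊢ x < y ∨ (x ≐ y ∨ y < x)) by apply (ax RCA), ax_lt_total.
apply (or_cases o); [intros H' I a; apply (l H' _ I (lt_diff a))|].
intros H1 I1 o1; apply (or_cases o1); intros H2 I2 a.
- apply e, a. exact (incl_tran I1 I2).
- eapply g, lt_diff, a. exact (incl_tran I1 I2).
Qed.

Lemma add_cancel H (x y z : term G N) : T; H ⊢ x + z ≐ y + z -> T; H ⊢ x ≐ y.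
Proof.
intros e. apply (@trichotomy _ x y); [up k d| |up k d].
- apply (@no_excess _ (x + z) k). toalg. rewrite e at 1. rewrite d. sring.
- intros H' _ d; exact d.
- apply (@no_excess _ (y + z) k). toalg. rewrite <- e at 1. rewrite d. sring.
Qed.

(** With [s = i + j], the code [s * s + i] lies between [s * s] and
    [s * s + s], which is below [(s + 1) * (s + 1)]; so a larger sum has a larger
    code.  The excess is an explicit term after [j] is added to both sides. *)
Lemma pair_sum_lt H (i j i' j' k : term G N) C :
  T; H ⊢ pair i j ≐ pair i' j' -> T; H ⊢ i' + j' ≐ ((i + j) + k) + one -> T; H ⊢ C.
Proof.
intros e s.
apply (@no_excess _ (((i + j) * (i + j) + i) + j)
  ((i + j) + two * (i + j) * k + k * k + two * k + i' + j)).
unfold pair in e. toalg. rewrite e at 1. rewrite s. sring.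
Qed.

Lemma pair_inj H (i j i' j' : term G N) : T; H ⊢ pair i j ≐ pair i' j' ->
  (T; H ⊢ i ≐ i') /\ (T; H ⊢ j ≐ j').
Proof.
intros e.
assert (s : T; H ⊢ i + j ≐ i' + j').
{ apply (@trichotomy _ (i + j) (i' + j')); [up k d| |up k d].
  - exact (pair_sum_lt _ e d).
  - intros H' _ d; exact d.
  - exact (pair_sum_lt _ (eq_sym e) d). }
assert (E : T; H ⊢ i ≐ i').
{ apply (@add_cancel _ _ _ ((i' + j') * (i' + j'))). unfold pair in e. toalg.
  rewrite s in e. etransitivity; [|etransitivity; [exact e|]]; sring. }
split; [exact E|].
apply (@add_cancel _ _ _ i'). toalg. rewrite E in s.
etransitivity; [|etransitivity; [exact s|]]; sring.
Qed.

Lemma ifz_iff H (x y : term G N) : T; H ⊢ ifz x y ≐ zero ⟷ (x ≐ zero ⟶ y ≐ zero).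
Proof.
apply iffI.
- up c. apply impI_gen. up z. exact (eq_trans (eq_sym (ifz_zero y z)) c).
- up i. apply (@nat_cases _ _ x); [up z|up k s].
  + exact (eq_trans (ifz_zero y z) (p_impE i z)).
  + exact (ifz_succ y s).
Qed.

Lemma one_neq_zero H C : T; H ⊢ (one : term G N) ≐ zero -> T; H ⊢ C.
Proof. intros e. apply (@no_excess _ zero zero). toalg. rewrite e. sring. Qed.

Lemma monus_iff H (x y : term G N) : T; H ⊢ monus x y ≐ zero ⟷ ¬ (y < x).
Proof.
apply iffI.
- up z. apply impI_gen. up l. apply (or_cases (monus_spec _ x y)).
  + up c. exact (negE _ (andE2 c) l).
  + up e. apply (@lt_irrefl _ _ x). refine (lt_congr _ (p_refl _ _ _) l).
    toalg. rewrite <- e, z. sring.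
- up n. apply (or_cases (monus_spec _ x y)); [up c|up e].
  + exact (andE1 c).
  + apply (@nat_cases _ _ (monus x y)); [intros H' _ d; exact d|up k s].
    apply (negE _ n), (@diff_lt _ _ _ k). toalg. rewrite s in e. rewrite <- e. sring.
Qed.

Lemma qle_excess H (p q : rexp G) M C : T; H ⊢ qle p q ->
  T; H ⊢ pos p * den q + neg q * den p ≐ ((pos q * den p + neg p * den q) + M) + one ->
  T; H ⊢ C.
Proof.
intros l e. apply (or_cases l); [up l'|up e'].
- exact (lt_irrefl _ (lt_trans l' (diff_lt e))).
- exact (no_excess _ (eq_trans (eq_sym e') e)).
Qed.

Definition ncode (x : term G N) : term G N := pair (pair x zero) zero.
Definition nrat (x : term G N) : rexp G := Rexp x zero (zero + one).

Lemma ncode_congr H (x y : term G N) : T; H ⊢ x ≐ y -> T; H ⊢ ncode x ≐ ncode y.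
Proof. intros e. unfold ncode, pair. toalg. rewrite e. reflexivity. Qed.

Lemma close_self H (x n : term G N) : T; H ⊢ qabslt (qsub (nrat x) (nrat x)) (qexp n).
Proof.
apply andI; apply (@diff_lt _ _ _ zero); unfold nrat, qexp; sring.
Qed.

(** Cleared of denominators, the right side exceeds the left by
    [pow2 n + 2 * pow2 k], which is positive because [pow2 n] is. *)
Lemma near_self H (x k n : term G N) :
  T; H ⊢ qabsle (qsub (nrat x) (nrat x)) (qadd (qexp k) (qexp2 n)).
Proof.
pose proof (lt_diff (pow2_pos H n)) as e.
set (m := prd _) in e.
apply andI; apply orI1, (@diff_lt _ _ _ (m + two * pow2 k)); unfold nrat, qexp, qexp2;
 toalg; rewrite e; sring.
Qed.

(** The tolerance at precision 2 and index 3 is 1/4 + 2/8 < 1, so naturals this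
    close are equal.  With common denominator 32 and [y = x + k + 1], the failing
    inequality reads [32 * y <= 32 * x + 16], which is off by [32 * k + 15] plus
    one.  Injectivity of pairing identifies the decoded fractions.  The numerals
    start from [zero] so that the recursion equations of [pow2] apply literally. *)
Lemma near_eq H (x y p n d p' n' d' : term G N) :
  T; H ⊢ ncode x ≐ pair (pair p n) d ->
  T; H ⊢ ncode y ≐ pair (pair p' n') d' ->
  T; H ⊢ qabsle (qsub (Rexp p n (d + one)) (Rexp p' n' (d' + one)))
    (qadd (qexp (zero + one + one)) (qexp2 (zero + one + one + one))) ->
  T; H ⊢ x ≐ y.
Proof.
intros c c' l.
pose proof (andE1 l) as l1. pose proof (andE2 l) as l2. clear l.
destruct (pair_inj c) as [pn ed]; destruct (pair_inj pn) as [ep en].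
destruct (pair_inj c') as [pn' ed']; destruct (pair_inj pn') as [ep' en'].
clear c c' pn pn'.
pose proof (pow2_zero H) as e0. pose proof (pow2_succ H zero) as e1.
pose proof (pow2_succ H (zero + one)) as e2.
pose proof (pow2_succ H (zero + one + one)) as e3.
set (s := two * two * two * two : term G N).
apply (@trichotomy _ x y); [up k e| |up k e].
- apply (@qle_excess _ _ _ (s * two * k + two * two * two + two * two + two + one) _ l2).
  unfold qexp, qexp2, s. toalg.
  rewrite e3, e2, e1, e0, <- ep, <- en, <- ed, <- ep', <- en', <- ed', e. sring.
- intros H' _ e; exact e.
- apply (@qle_excess _ _ _ (s * two * k + two * two * two + two * two + two + one) _ l1).
  unfold qexp, qexp2, s. toalg.
  rewrite e3, e2, e1, e0, <- ep, <- en, <- ed, <- ep', <- en', <- ed', e. sring.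
Qed.

End Solver.
End Arithmetic.

(** * Arithmetical comprehension *)

Fixpoint arith G (A : fm G) : Prop :=
  match A with
  | Eq _ _ | Lt _ _ | Bot => True
  | Imp A B => arith A /\ arith B
  | All s A => s = N /\ arith A
  end.

(** The consequence of [mu2] by which [m] acts as a quantifier:
    [f (m f) = 0] iff [f] has a zero. *)
Definition searches G (m : term G T2) : fm G :=
  ∀' f ∶ T1, ∀' n ∶ N, ↑f · ↑n ≐ zero ⟶ ↑f · (↑m · ↑f) ≐ zero.

Section Comprehension.
Context (T : theory) (RCA : forall G (A : fm G), RCA0w A -> T G A).

Lemma wkf_searches G s (m : term G T2) : wkf s (searches m) = searches (wk s m).
Proof.
unfold searches, all_, wkf, lift, wk; simpl; rewrite !ren_ren; reflexivity.
Qed.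

Lemma searchesE G (H : list (fm G)) (m : term G T2) (f : term G T1) (n : term G N) :
  T; H ⊢ searches m -> T; H ⊢ f · n ≐ zero -> T; H ⊢ f · (m · f) ≐ zero.
Proof.
intros s. pose proof (p_allE n (p_allE f s)) as P.
unfold inst, lift in P; cbn in P. unfold wk in P; rewrite !sub_ren in P.
rewrite (@sub_var _ _ (fun _ => vs) _ _ m), sub_ren, !sub_id in P by reflexivity.
exact (p_impE P).
Qed.

Lemma iff_sym G (H : list (fm G)) A B : T; H ⊢ A ⟷ B -> T; H ⊢ B ⟷ A.
Proof. intros ab; apply andI; [exact (andE2 ab)|exact (andE1 ab)]. Qed.

Lemma iff_trans G (H : list (fm G)) A B C :
  T; H ⊢ A ⟷ B -> T; H ⊢ B ⟷ C -> T; H ⊢ A ⟷ C.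
Proof.
intros ab bc; apply iffI; up h.
- exact (iffE1 bc (iffE1 ab h)).
- exact (iffE2 ab (iffE2 bc h)).
Qed.

Lemma imp_iff G (H : list (fm G)) A B A' B' :
  T; H ⊢ A ⟷ A' -> T; H ⊢ B ⟷ B' -> T; H ⊢ (A ⟶ B) ⟷ (A' ⟶ B').
Proof.
intros a b; apply iffI; up h; apply impI_gen; up h'.
- exact (iffE1 b (p_impE h (iffE2 a h'))).
- exact (iffE2 b (p_impE h (iffE1 a h'))).
Qed.

Lemma one_iff_bot G (H : list (fm G)) : T; H ⊢ one ≐ zero ⟷ Bot.
Proof. apply iffI; up h; [exact (one_neq_zero RCA _ h)|exact (botE _ h)]. Qed.

Lemma ifz_not G (H : list (fm G)) x A :
  T; H ⊢ x ≐ zero ⟷ A -> T; H ⊢ ifz x one ≐ zero ⟷ ¬ A.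
Proof.
intros e. apply (iff_trans (ifz_iff RCA _ _ _)).
exact (imp_iff e (one_iff_bot _)).
Qed.

(** This reduces equality to order, which truncated subtraction decides. *)
Lemma eq_iff_not_lt G (H : list (fm G)) (u v : term G N) :
  T; H ⊢ u ≐ v ⟷ (¬ (u < v) ∧ ¬ (v < u)).
Proof.
apply iffI.
- up e. apply andI; apply impI_gen; up l; apply (lt_irrefl RCA (x := v)).
  + exact (lt_congr e (p_refl _ _ _) l).
  + exact (lt_congr (p_refl _ _ _) e l).
- up n. apply (trichotomy RCA (x := u) (y := v)); [up k e| |up k e].
  + exact (negE _ (andE1 n) (diff_lt RCA e)).
  + intros H' _ e; exact e.
  + exact (negE _ (andE2 n) (diff_lt RCA e)).
Qed.

(** The term [x] may depend on the free variables of [A] and is independent of the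
    hypotheses.  The quantifier is decided by applying [m] to the function [f]
    that vanishes at the counterexamples of [A].  The hypothesis on [m] is a member
    of [H] and not merely derivable from it, so that it survives the passage to
    the context of the bound variable. *)
Lemma arith_decision G (A : fm G) : arith A -> forall m : term G T2,
  exists x : term G N, forall H, In (searches m) H -> T; H ⊢ x ≐ zero ⟷ A.
Proof.
induction A as [G u v|G u v|G|G A IHA B IHB|G s A IH]; intros a m.
- exists (ifz (ifz (monus v u) (ifz (monus u v) one)) one). intros H _.
  apply (iff_trans (B := ¬ (u < v) ∧ ¬ (v < u))); [|apply iff_sym, eq_iff_not_lt].
  apply ifz_not. apply (iff_trans (ifz_iff RCA _ _ _)).
  apply imp_iff; [apply (monus_iff RCA)|apply ifz_not, (monus_iff RCA)].
- exists (ifz (monus v u) one). intros H _.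
  apply (iff_trans (ifz_not (monus_iff RCA _ _ _))).
  apply iffI; up h.
  + apply (em_cases (A := u < v)); [intros H' _ l; exact l|up n].
    exact (negE _ h n).
  + apply impI_gen; up n. exact (p_impE n h).
- exists one. intros H _. apply one_iff_bot.
- destruct a as [a b]. destruct (IHA a m) as [x ex], (IHB b m) as [y ey].
  exists (ifz x y). intros H h. apply (iff_trans (ifz_iff RCA _ _ _)).
  apply imp_iff; auto.
- destruct a as [-> a]. destruct (IH a (wk _ m)) as [x ex].
  set (f := lam (ifz x one)).
  assert (ef : forall H, In (searches (wk N m)) H ->
    T; H ⊢ wk N f · Var vz ≐ zero ⟷ ¬ A).
  { intros H h. apply (iff_trans (B := ifz x one ≐ zero)).
    - pose proof (lam_beta RCA (ifz x one) H) as e.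
      apply iffI; up z; [exact (eq_trans (eq_sym e) z)|exact (eq_trans e z)].
    - apply ifz_not; auto. }
  exists (ifz (f · (m · f)) one). intros H h.
  assert (h' : forall H', incl H H' -> In (searches (wk N m)) (map (@wkf G N) H')).
  { intros H' I. rewrite <- wkf_searches. apply in_map; auto. }
  apply (iff_trans (B := ¬ (f · (m · f) ≐ zero))); [apply ifz_not, iffI; up e; exact e|].
  apply andI; apply p_impI.
  + apply p_allI.
    assert (i := h' _ (incl_tl (¬ (f · (m · f) ≐ zero)) (incl_refl H))).
    set (H' := map _ _) in *.
    assert (q : T; H' ⊢ ¬ (wk N f · (wk N m · wk N f) ≐ zero)) by (apply p_hyp; left; reflexivity).
    apply (em_cases (A := A)); [intros ? _ e; exact e|up n].
    apply (negE _ q). apply (searchesE (n := Var vz)); [now apply p_hyp|].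
    exact (iffE2 (ef _ i) n).
  + assert (z : T; All N A :: H ⊢ All N (¬ (wk N f · Var vz ≐ zero))).
    { apply p_allI. assert (i := h' _ (incl_tl (All N A) (incl_refl H))).
      set (H' := map _ _) in *.
      assert (b : T; H' ⊢ A).
      { rewrite <- (inst_wk_vz A). apply p_allE, p_hyp. left. reflexivity. }
      apply impI_gen; up z. exact (negE _ (iffE1 (ef _ i) z) b). }
    apply (p_allE (m · f)) in z. unfold inst in z; cbn -[wk f] in z.
    rewrite sub_wk in z. exact z.
Qed.

(** In [renf (ren_up (fun _ => vs)) A] the variable of the new set is skipped: the
    formula [A] speaks about [n] and the outer context. *)
Lemma arith_comprehension G (H : list (fm G)) (m : term G T2) (A : fm (N :: G)) :
  arith A -> In (searches m) H ->
  T; H ⊢ ∃' X ∶ T1, (IsSet ↑X ∧ ∀' n ∶ N, (↑n ∈ ↑X ⟷ renf (ren_up (fun _ => vs)) A)).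
Proof.
intros a h. destruct (arith_decision a (wk _ m)) as [x ex].
set (X := lam (ifz x one)).
apply (exI (u := X)).
assert (E : subf (sub_up (s := N) (scons X (fun _ => Var))) (renf (ren_up (fun _ => vs)) A) = A)
  by (apply subf_renf_id; apply var_case; reflexivity).
unfold inst; cbn -[X]; unfold inst; cbn -[X]. rewrite E.
change (T; H ⊢ All N (wk N X · Var vz ≐ zero ∨ wk N X · Var vz ≐ one) ∧
     All N (wk N X · Var vz ≐ one ⟷ A)).
pose proof (fun H' => lam_beta RCA (ifz x one) H' : T; H' ⊢ wk N X · Var vz ≐ ifz x one) as e.
apply andI; apply p_allI; set (H' := map _ H).
- apply (nat_cases RCA (u := x)); [up z|up k s].
  + apply orI2, (eq_trans (e _)), (ifz_zero RCA), z.
  + apply orI1, (eq_trans (e _)), (ifz_succ RCA _ s).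
- assert (h' : In (searches (wk N m)) H') by (rewrite <- wkf_searches; now apply in_map).
  apply (iff_trans (B := x ≐ zero)); [|now apply ex].
  apply iffI.
  + up o. apply (nat_cases RCA (u := x)); [intros ? _ z; exact z|up k s].
    apply (one_neq_zero RCA).
    exact (eq_trans (eq_sym o) (eq_trans (e _) (ifz_succ RCA _ s))).
  + up z. exact (eq_trans (e _) (ifz_zero RCA _ z)).
Qed.

End Comprehension.

(** * The range of a functional as a separably closed set *)

Section Range.
Context (T : theory) (RCA : forall G (A : fm G), RCA0w A -> T G A).

Lemma lam_app G (H : list (fm G)) s (b : term (s :: G) N) (u : term G s) :
  T; H ⊢ lam b · u ≐ sub (scons u (fun _ => Var)) b.
Proof.
assert (e : T; H ⊢ All s (wk s (lam b) · Var vz ≐ b)) by (apply p_allI, (lam_beta RCA b)).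
apply (p_allE u) in e. unfold inst in e; cbn -[wk lam] in e.
rewrite sub_wk in e. exact e.
Qed.

Definition everything G : term G T2 := Pi N T1 · one.
Definition total_rel G : term G (T1 ⇒ T1 ⇒ N) := Pi (T1 ⇒ N) T1 · (Pi N T1 · one).

(** The parameter is a variable, not a term: weakening and substitution then compute
    through [lam], and the net in a larger context is convertible to [range_net] of
    the shifted variable. *)
Definition range_net G (h : var G T2) : term G T2 := lam (ncode (Var (vs h) · Var vz)).

Lemma range_net_app G (H : list (fm G)) (h : var G T2) d :
  T; H ⊢ range_net h · d ≐ ncode (Var h · d).
Proof. apply (lam_app H (ncode (Var (vs h) · Var vz))). Qed.

Lemma total_rel_app G (H : list (fm G)) x y : T; H ⊢ total_rel G · x · y ≐ one.
Proof.
refine (eq_trans (_ : T; _ ⊢ _ ≐ Pi N T1 · one · y) (const_beta RCA _ _ _)).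
exact (eqt_app (s := T1) (t := N) y (ax RCA H (ax_Pi (Pi N T1 · one) x))).
Qed.

Lemma range_net_rat_net G (H : list (fm G)) (h : var G T2) :
  T; H ⊢ rat_net (everything G) (total_rel G) (range_net h).
Proof.
apply andI; [|apply andI; [|apply andI; [repeat apply andI|]]].
- apply p_allI, orI2, (const_beta RCA).
- do 2 apply p_allI. apply orI2, total_rel_app.
- apply (exI (u := Pi N N · one)). apply (const_beta RCA).
- do 3 apply p_allI. do 5 apply p_impI. apply total_rel_app.
- apply p_allI, p_impI, total_rel_app.
- do 2 apply p_allI. do 2 apply p_impI. apply (exI (u := Var vz)).
  apply andI; [apply (const_beta RCA)|apply andI; apply total_rel_app].
- apply p_allI, p_impI.
  apply (exI (u := Var (vs h) · Var vz)), (exI (u := zero)), (exI (u := zero)).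
  apply andI; [|apply p_impI, hyp0].
  apply (range_net_app _ (vs h) (Var vz)).
Qed.

Lemma natural_is_real G (H : list (fm G)) (n : var G N) :
  T; H ⊢ IsReal (real_of_rat (ncode (Var n))).
Proof.
apply andI; [apply p_allI|do 2 apply p_allI].
- apply (exI (u := Var (vs n))), (exI (u := zero)), (exI (u := zero)).
  apply andI; [apply (const_beta RCA)|apply p_impI, hyp0].
- apply (exI (u := Var (vs (vs n)))), (exI (u := zero)), (exI (u := zero)).
  apply andI; [apply (const_beta RCA)|].
  apply (exI (u := Var (vs (vs n)))), (exI (u := zero)), (exI (u := zero)).
  apply andI; [apply (const_beta RCA)|].
  apply (close_self RCA).
Qed.

(** Precision 2 and index 3 suffice to identify [n] with a value of the net. *)
Lemma range_net_closure G (H : list (fm G)) (h : var G T2) (n : var G N) :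
  T; H ⊢ in_sep_closed (everything G) (range_net h) (real_of_rat (ncode (Var n))) ⟷
    ∃' f ∶ T1, Var (vs h) · ↑f ≐ Var (vs n).
Proof.
apply andI; apply p_impI.
- eapply exE; [exact (p_allE (zero + one + one) (hyp0 _ _ _))|].
  (* The index of the nearby member is the witness. *)
  apply (exI (u := Var vz)).
  eapply exE; [exact (p_allE (zero + one + one + one) (andE2 (hyp0 _ _ _)))|].
  do 2 (eapply exE; [apply hyp0|]).
  eapply exE; [exact (andE2 (hyp0 _ _ _))|].
  do 2 (eapply exE; [apply hyp0|]).
  apply eq_sym.
  eapply (near_eq RCA); [| |exact (andE2 (hyp0 _ _ _))].
  + eapply eq_trans; [apply eq_sym, (const_beta RCA)|].
    (* Behind the three formulas from decoding the value of the net. *)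
    eapply andE1, p_hyp. do 3 right. left. reflexivity.
  + eapply eq_trans; [apply eq_sym, range_net_app|]. exact (andE1 (hyp0 _ _ _)).
- apply p_allI.
  eapply exE; [apply p_hyp; left; reflexivity|].
  apply (exI (u := Var vz)), andI; [apply (const_beta RCA)|].
  apply p_allI.
  apply (exI (u := Var (vs (vs (vs n))))), (exI (u := zero)), (exI (u := zero)).
  apply andI; [apply (const_beta RCA)|].
  (* The value of the net is decoded as [n], so both fractions are literally the
     same. *)
  apply (exI (u := Var (vs (vs (vs n))))), (exI (u := zero)), (exI (u := zero)).
  apply andI; [|apply (near_self RCA)].
  apply (eq_trans (range_net_app _ (vs (vs (vs h))) (Var (vs vz)))).
  apply ncode_congr, p_hyp. left. reflexivity.
Qed.

End Range.

(** [recall t as h] derives a hypothesis over the list of the current goal, which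
    fixes the formula before [t] is elaborated. *)
Tactic Notation "recall" uconstr(t) "as" ident(h) :=
  match goal with |- @prov ?T ?G ?H _ => pose proof (t : @prov T G H _) as h end.

Lemma mu_searches T G (H : list (fm G)) : T; H ⊢ mu2 G -> T; H ⊢ ∃' m ∶ T2, searches ↑m.
Proof.
intros m. eapply exE; [exact m|].
apply (exI (u := Var vz)).
do 2 apply p_allI. apply p_impI.
recall (hyp1 T _ _ _) as h.
apply (p_allE (Var (vs vz))), andE1 in h.
apply (fun c => andE1 (p_impE h c)).
apply (exI (u := Var vz)), hyp0.
Qed.

Theorem theorem3p19 : provable ACA0w_Delta_CA (Imp (CLO []) (RANGE [])).
Proof.
assert (RCA : forall G (A : fm G), RCA0w A -> ACA0w_Delta_CA A)
  by (intros; now apply ACA0w_Delta_CA_ACA, ACA0w_RCA).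
apply p_impI, p_allI.
eapply exE; [apply mu_searches, p_ax, ACA0w_Delta_CA_ACA, ACA0w_mu|].
recall (hyp1 ACA0w_Delta_CA _ _ _) as clo.
apply (p_allE (everything _)), (p_allE (total_rel _)), (p_allE (range_net (vs vz))) in clo.
eapply exE; [apply (p_impE clo), (range_net_rat_net RCA _ (vs vz))|].
clear clo.
eapply exE; [apply hyp0|].
(* In this context the variables are [b], [a], [mu] and [H], innermost first. *)
eapply exE; [apply (arith_comprehension RCA (m := Var (vs (vs vz)))
    (A := ¬ in_RM_open (Var (vs (vs vz))) (Var (vs vz)) (real_of_rat (ncode (Var vz)))))|].
- cbn; repeat split.
- do 2 right. left. reflexivity.
- apply (exI (u := Var vz)), andI; [exact (andE1 (hyp0 _ _ _))|].
  apply p_allI.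
  recall (hyp0 ACA0w_Delta_CA _ _) as set_def.
  apply andE2, (p_allE (Var vz)) in set_def.
  recall (hyp1 ACA0w_Delta_CA _ _ _) as closure.
  apply andE2, andE2, (p_allE (real_of_rat (ncode (Var vz)))) in closure.
  apply (iff_trans set_def).
  apply (iff_trans (iff_sym (p_impE closure (natural_is_real RCA _ vz)))).
  apply (range_net_closure RCA _ (vs (vs (vs (vs (vs vz))))) vz).
Qed.
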